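(* Suppose $A_0>0$ and define $\tau:=\frac{A_0}{\pi}$. Then there exists a sequence of Lipschitz functions $y_0^n:\mathbb{R}\to[0,\infty)$ with $\|y_0^n\|_{L^1(\mathbb{R})}=A_0$ for each $n\in\mathbb{N}$, such that the unique Ecker-Huisken solutions $y^n:\mathbb{R}\times[0,\infty)\to\mathbb{R}$ of graphical curve shortening flow $y_t=\frac{y_{xx}}{1+y_x^2}$ starting with $y_0^n$ satisfy that for every $t_0\in(0,\tau]$ we have $$\|y^n(\cdot,t_0)\|_{L^\infty(\mathbb{R})}\to\infty\qquad\text{and}\qquad \|y^n_x(\cdot,t_0)\|_{L^\infty(\mathbb{R})}\to\infty$$ as $n\to\infty$.
   Context: Graphical curve shortening flow is the equation $y_t=\frac{y_{xx}}{1+y_x^2}=(\arctan y_x)_x$. For every locally Lipschitz $y_0:\mathbb{R}\to\mathbb{R}$ there is (Ecker-Huisken existence, Chou-Zhu uniqueness) a unique continuous function $y:\mathbb{R}\times[0,\infty)\to\mathbb{R}$ that is smooth and solves this equation on $\mathbb{R}\times(0,\infty)$, with $y(\cdot,0)=y_0$ and $y(\cdot,t)\to y_0$ locally uniformly as $t\downarrow 0$. It is called the Ecker-Huisken solution starting with $y_0$. *)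

(* Defs.v *)
From HB Require Import structures.
From mathcomp Require Import all_boot all_order all_algebra.
From mathcomp Require Import all_classical all_reals all_analysis.
Set Implicit Arguments.
Unset Strict Implicit.
Unset Printing Implicit Defensive.
Import Order.TTheory GRing.Theory Num.Theory.
Import numFieldNormedType.Exports.
Local Open Scope classical_set_scope.
Local Open Scope ring_scope.

Section CurveShortening.
Context {R : realType}.
Implicit Types u y : R -> R -> R.

(* Functions of space and time are curried, [y x t].  [derive1] is total, so
   these are meaningful only where the partial derivatives exist. *)
Definition dx u : R -> R -> R := fun x t => derive1 (u ^~ t) x.
Definition dt u : R -> R -> R := fun x t => derive1 (u x) t.

(* Classical C^k on an open set D: all iterated partial derivatives up to order
   k, in any order of differentiation, exist and are jointly continuous at
   every point of D. *)
Fixpoint Ck_on (k : nat) (D : set (R * R)) u : Prop :=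
  (forall p, D p -> {for p, continuous (fun q : R * R => u q.1 q.2)}) /\
  match k with
  | 0 => True
  | k'.+1 =>
      [/\ forall p, D p ->
            derivable (u ^~ p.2) p.1 1 /\ derivable (u p.1) p.2 1,
          Ck_on k' D (dx u) &
          Ck_on k' D (dt u)]
  end.

Definition smooth_on (D : set (R * R)) u : Prop := forall k, Ck_on k D u.

(* A solution lives on R x [0, oo): the values [y x t] for t < 0 are junk and
   no clause depends on them. *)
Definition Ecker_Huisken_solution (y0 : R -> R) y : Prop :=
  [/\ {within [set p : R * R | 0 <= p.2],
         continuous (fun p : R * R => y p.1 p.2)},
      forall x, y x 0 = y0 x,
      {family compact, (fun t x => y x t) @ 0^'+ --> y0},
      smooth_on [set p : R * R | 0 < p.2] y &
      forall x t : R, 0 < t ->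
        dt y x t = dx (dx y) x t / (1 + dx y x t ^+ 2)].

End CurveShortening.

(* Main.v *)
Require Import Defs.
From HB Require Import structures.
From mathcomp Require Import all_boot all_order all_algebra.
From mathcomp Require Import all_classical all_reals all_analysis.
From mathcomp Require Import ess_sup_inf ring lra.
Set Implicit Arguments.
Unset Strict Implicit.
Unset Printing Implicit Defensive.
Import Order.TTheory GRing.Theory Num.Theory.
Import numFieldNormedType.Exports.
Local Open Scope classical_set_scope.
Local Open Scope ring_scope.

(** The data are tents of area [A0] supported in [-w, w], with [w -> 0].  The
    flux [atan y_x] is bounded by [pi / 2], so testing the difference of two
    solutions against [h(u) (b - x)] yields a comparison principle without any
    condition at infinity; with reflections it shows that [y] decreases in
    [x >= 0].

    Write [D = pi / 2 + atan y_x >= 0] for the defect of the flux on [x >= 0].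
    Half of the spike loses area at rate at most [pi / 2], so for [t0 <= A0 / pi]
    a bound [y(0, t0) <= M] leaves no room for much area outside the spike
    earlier: [y(2w, s) <= 2 M] for all [s <= t0].  As [- y_x = cot D], this
    forces [D / x ^ 2] to have a large integral over [2w, 1].  But that integral
    is the growth rate of the area weighted by [1 / x], up to the loss
    that the initial area compensates, and at time [t0] the weighted area is at
    most [M ln (1 / 2w)].  The two estimates give
    [t0 ln (1 / 2w) <= M (1 + A0 / 2 + 2 M)], hence [M -> oo].  Since the area on
    [0, 1] stays below [A0], so does [y(1, t0)], and the slope blows up too. *)

(** * Integrals of continuous functions *)

(** The integral carries no orientation: it is 0 when [b < a], hence the recurring hypothesis
    [a <= b]. *)
Definition integral_on {R : realType} (a b : R) (f : R -> R) : R :=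
  \int[lebesgue_measure]_(x in `[a, b]) f x.

Section IntegralOn.
Context {R : realType}.
Implicit Types (a b c k : R) (f g F : R -> R).
Local Notation mu := (@lebesgue_measure R).

Lemma continuous_integrable_on a b f :
  continuous f -> mu.-integrable `[a, b] (EFin \o f).
Proof.
move=> cf; apply: continuous_compact_integrable; first exact: segment_compact.
exact: continuous_subspaceT.
Qed.

Lemma integral_on_add a b f g : continuous f -> continuous g ->
  integral_on a b (fun x => f x + g x) = integral_on a b f + integral_on a b g.
Proof.
by move=> cf cg; rewrite /integral_on RintegralD//; exact: continuous_integrable_on.
Qed.

Lemma integral_onZ a b k f : continuous f ->
  integral_on a b (fun x => k * f x) = k * integral_on a b f.
Proof.
by move=> cf; rewrite /integral_on RintegralZl//; exact: continuous_integrable_on.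
Qed.

Lemma integral_on_cst a b k : a <= b -> integral_on a b (fun=> k) = k * (b - a).
Proof.
move=> ab; rewrite /integral_on Rintegral_cst//.
have := lebesgue_measure_itv `[a, b]; rewrite /= lte_fin => E.
rewrite [X in fine X](_ : _ = (if (a < b)%R then b%:E - a%:E else 0)%E); last first.
  exact: E.
move: ab; rewrite le_eqVlt => /predU1P[->|->]; last by rewrite -EFinB.
by rewrite ltxx subrr.
Qed.

Lemma eq_integral_on a b f g : (forall x, a <= x <= b -> f x = g x) ->
  integral_on a b f = integral_on a b g.
Proof.
by move=> fg; apply: eq_Rintegral => x; rewrite inE/= in_itv/=; exact: fg.
Qed.

Lemma le_integral_on a b f g : continuous f -> continuous g ->
  (forall x, a <= x <= b -> f x <= g x) ->
  integral_on a b f <= integral_on a b g.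
Proof.
by move=> cf cg fg; apply: le_Rintegral => //; exact: continuous_integrable_on.
Qed.

Lemma integral_on_ge0 a b f : (forall x, a <= x <= b -> 0 <= f x) ->
  0 <= integral_on a b f.
Proof.
by move=> f0; apply: Rintegral_ge0 => x; rewrite /= in_itv/=; exact: f0.
Qed.

Lemma integral_on_cat b a c f : continuous f -> a <= b -> b <= c ->
  integral_on a c f = integral_on a b f + integral_on b c f.
Proof.
move=> cf ab bc.
have H : integral_on a c f - integral_on a b f =
    \int[mu]_(x in [set` Interval (BRight b) (BRight c)]) f x.
  apply: (@Rintegral_itvB R f (BLeft a) (BRight c) b) => //.
  exact: continuous_integrable_on.
rewrite -[LHS](subrK (integral_on a b f)) H addrC; congr (_ + _).
 apply: Rintegral_itv_obnd_cbnd.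
apply: (integrableS _ _ _ (continuous_integrable_on b c cf)) => //.
by apply: subset_itvr; rewrite bnd_simp.
Qed.

Lemma integral_on_derive a b F f : a <= b -> continuous f ->
  (forall x, a <= x <= b -> is_derive x 1 F (f x)) ->
  integral_on a b f = F b - F a.
Proof.
rewrite le_eqVlt => /predU1P[<- _ _|ab cf dF].
  by rewrite /integral_on set_itv1 Rintegral_set1 subrr.
have cF x : a <= x <= b -> {for x, continuous F}.
  move=> /dF dFx; apply/differentiable_continuous/derivable1_diffP.
  exact: ex_derive.
rewrite /integral_on /Rintegral (@continuous_FTC2 _ f F) //.
- exact: continuous_subspaceT.
- split.
  + move=> x; rewrite in_itv/= => /andP[ax xb].
    by apply: ex_derive; apply: dF; rewrite !ltW.
  + by apply: cvg_at_right_filter; apply: cF; rewrite lexx ltW.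
  + by apply: cvg_at_left_filter; apply: cF; rewrite lexx ltW.
- move=> x; rewrite in_itv/= => /andP[ax xb]; rewrite derive1E.
  by apply: derive_val; apply: dF; rewrite !ltW.
Qed.

End IntegralOn.

(** * Joint continuity and differentiation under the integral *)

Notation jcontinuous_at F x t :=
  {for (x, t), continuous (fun z : _ * _ => F z.1 z.2)}.

Section JointContinuity.
Context {R : realType}.
Implicit Types (x t a b : R) (F G : R -> R -> R).

Lemma jcontinuous_fst F x t :
  jcontinuous_at F x t -> {for x, continuous (F ^~ t)}.
Proof.
move=> cF; have cp : {for x, continuous (fun x => (x, t))}.
  apply: (@cvg_pair R R R (nbhs x) (nbhs x) (nbhs t)).
    exact: cvg_id.
  exact: cvg_cst.
exact: (continuous_comp cp cF).
Qed.

Lemma jcontinuous_snd F x t :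
  jcontinuous_at F x t -> {for t, continuous (F x)}.
Proof.
move=> cF; have cp : {for t, continuous (fun t => (x, t))}.
  apply: (@cvg_pair R R R (nbhs t) (nbhs x) (nbhs t)).
    exact: cvg_cst.
  exact: cvg_id.
exact: (continuous_comp cp cF).
Qed.

Lemma jcontinuous_of_fst (f : R -> R) x t :
  {for x, continuous f} -> jcontinuous_at (fun x _ : R => f x) x t.
Proof.
move=> cf; have cfst : {for (x, t), continuous (@fst R R)} by exact: cvg_fst.
exact: (continuous_comp cfst cf).
Qed.

Lemma jcontinuous_bounded F a b t1 t2 :
  (forall x t, t1 <= t <= t2 -> jcontinuous_at F x t) ->
  exists M, 0 <= M /\
    forall x t, a <= x <= b -> t1 <= t <= t2 -> `|F x t| <= M.
Proof.
move=> cF.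
have /compact_bounded[M [Mr MF]] :
    compact ((fun z : R * R => F z.1 z.2) @` (`[a, b] `*` `[t1, t2])).
  apply: continuous_compact; last first.
    by apply: compact_setX; exact: segment_compact.
  apply: continuous_in_subspaceT => -[x t].
  by rewrite inE => -[/= _]; rewrite in_itv/=; exact: cF.
exists (`|M| + 1); split; first by rewrite addr_ge0.
move=> x t xab tt; apply: (MF (`|M| + 1)).
  by rewrite (le_lt_trans (ler_norm _))// ltrDl.
by exists (x, t) => //; split => /=; rewrite in_itv/=.
Qed.

(** Dominated convergence: near [t] the integrand is bounded by a constant on the compact rectangle
    [a, b] x [t - 1, t + 1]. *)
Lemma continuous_integral_on F a b :
  (forall x t, jcontinuous_at F x t) ->
  continuous (fun t => integral_on a b (F ^~ t)).
Proof.
move=> cF t.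
have [M [M0 FM]] := @jcontinuous_bounded F a b (t - 1) (t + 1)
  (fun x s _ => cF x s).
have cFt s : continuous (F ^~ s) by move=> x; exact/jcontinuous_fst/cF.
have := @continuity_under_integral R _ _ lebesgue_measure
  (fun t x => F x t) `[a, b] (measurable_itv _) (t - 1) (t + 1).
move=> /(_ _ _ (fun=> M)) H.
apply: H.
- by move=> s _; exact: continuous_integrable_on.
- by apply: aeW => x _ s _; exact/jcontinuous_snd/cF.
- by apply: continuous_integrable_on => ?; exact: cvg_cst.
- move=> s; rewrite /= in_itv/= => /andP[s1 s2]; apply: aeW => x.
  by rewrite /= in_itv/= => xab; apply: FM => //; rewrite !ltW.
- by rewrite inE/= in_itv/=; lra.
Qed.

Lemma is_derive_integral_on F G a b t :
  0 < t -> (forall s, continuous (F ^~ s)) ->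
  (forall (x s : R), 0 < s -> is_derive s 1 (F x) (G x s)) ->
  (forall (x s : R), 0 < s -> jcontinuous_at G x s) ->
  is_derive t 1 (fun t => integral_on a b (F ^~ t)) (integral_on a b (G ^~ t)).
Proof.
move=> t0 cF dF cG.
(* The dominating constant comes from a time interval that stays away from 0, since [G] is only
   controlled at positive times. *)
have [|M [M0 GM]] := @jcontinuous_bounded G a b (t / 2) (t * 2).
  by move=> x s /andP[ts _]; apply: cG; apply: lt_le_trans ts; lra.
have It : `]t / 2, t * 2[%classic t by rewrite /= in_itv/=; lra.
have Ipos s : `]t / 2, t * 2[%classic s -> 0 < s.
  by rewrite /= in_itv/= => /andP[ts _]; apply: lt_trans ts; lra.
have E x s : 0 < s -> partial1of2 (fun t x => F x t) s x = G x s.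
  by move=> s0; rewrite /partial1of2 derive1E; apply: derive_val; exact: dF.
have ciF s : `]t / 2, t * 2[%classic s ->
    lebesgue_measure.-integrable `[a, b] (EFin \o (F ^~ s)).
  by move=> _; exact: continuous_integrable_on.
have derF s x : `]t / 2, t * 2[%classic s -> `[a, b]%classic x ->
    derivable (F x) s 1.
  by move=> /Ipos s0 _; apply: ex_derive; exact: dF.
have M_int : lebesgue_measure.-integrable `[a, b] (EFin \o (fun=> M)).
  by apply: continuous_integrable_on => ?; exact: cvg_cst.
have M_ub s x : `]t / 2, t * 2[%classic s -> `[a, b]%classic x ->
    `|partial1of2 (fun t x => F x t) s x| <= M.
  move=> Is; rewrite /= in_itv/= => xab; rewrite E; last exact: Ipos.
  by apply: GM => //; move: Is; rewrite /= in_itv/= => /andP[? ?]; rewrite !ltW.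
have -> : integral_on a b (G ^~ t) =
    integral_on a b (fun x => partial1of2 (fun t x => F x t) t x).
  by apply: eq_integral_on => x _; rewrite E.
apply: DeriveDef.
- exact: (@derivable_under_integral R _ _ lebesgue_measure
    (fun t x => F x t) _ (measurable_itv _) t (t / 2) (t * 2) It ciF derF
    (fun=> M) _ M_int M_ub).
- rewrite -derive1E.
  exact: (@differentiation_under_integral R _ _ lebesgue_measure
    (fun t x => F x t) _ (measurable_itv _) t (t / 2) (t * 2) It ciF derF
    (fun=> M) _ M_int M_ub).
Qed.

(** The derivative is given at positive times only, while [f] is continuous everywhere; so the
    estimate may start at [s = 0], the time of the initial data. *)
Lemma le_of_derive_le (f df : R -> R) C s t : 0 <= s <= t ->
  continuous f -> (forall r : R, 0 < r -> is_derive r 1 f (df r)) ->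
  (forall r, s < r < t -> df r <= C) ->
  f t <= f s + C * (t - s).
Proof.
move=> /andP[s0]; rewrite le_eqVlt => /predU1P[<- _ _ _|st cf dfE dfC].
  by rewrite subrr mulr0 addr0.
have [|c cst E] := @MVT R f df s t st _ (continuous_subspaceT cf).
  move=> r; rewrite in_itv/= => /andP[sr _]; apply: dfE.
  exact: le_lt_trans sr.
rewrite -lerBlDl E ler_wpM2r//; first by rewrite subr_ge0 ltW.
by apply: dfC; move: cst; rewrite in_itv.
Qed.

End JointContinuity.

(** * Pointwise calculus *)

Section PointwiseCalculus.
Context {R : realType} {T : topologicalType}.
Implicit Types (f g : T -> R) (z : T).

Lemma continuous_addf f g z : {for z, continuous f} -> {for z, continuous g} ->
  {for z, continuous (fun z => f z + g z)}.
Proof. by move=> cf cg; exact: cvgD. Qed.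

Lemma continuous_subf f g z : {for z, continuous f} -> {for z, continuous g} ->
  {for z, continuous (fun z => f z - g z)}.
Proof. by move=> cf cg; exact: cvgB. Qed.

Lemma continuous_mulf f g z : {for z, continuous f} -> {for z, continuous g} ->
  {for z, continuous (fun z => f z * g z)}.
Proof. by move=> cf cg; exact: cvgM. Qed.

Lemma continuous_scalef (k : R) f z : {for z, continuous f} ->
  {for z, continuous (fun z => k * f z)}.
Proof. by move=> cf; apply: cvgM => //; exact: cvg_cst. Qed.

Lemma continuous_divf f g z : {for z, continuous f} -> {for z, continuous g} ->
  g z != 0 -> {for z, continuous (fun z => f z / g z)}.
Proof. by move=> cf cg g0; apply: cvgM => //; exact: cvgV. Qed.

Lemma continuous_compf (h : R -> R) f z : {for f z, continuous h} ->
  {for z, continuous f} -> {for z, continuous (fun z => h (f z))}.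
Proof. by move=> ch cf; exact: (continuous_comp cf ch). Qed.

End PointwiseCalculus.

Lemma continuous_pos_part {R : realType} (x : R) :
  {for x, continuous (fun v : R => Num.max v 0)}.
Proof. by apply: continuous_max; [exact: cvg_id|exact: cvg_cst]. Qed.

Section PointwiseDerivatives.
Context {R : realType}.
Implicit Types (f g h : R -> R) (x df dg dh : R).

Lemma is_derive_continuous f x df : is_derive x 1 f df -> {for x, continuous f}.
Proof.
by move=> dfx; apply/differentiable_continuous/derivable1_diffP; exact: ex_derive.
Qed.

Lemma is_derive_cstf (k : R) x : is_derive x 1 (fun=> k) 0.
Proof. exact: is_derive_cst. Qed.

Lemma is_derive_addf f g x df dg : is_derive x 1 f df -> is_derive x 1 g dg ->
  is_derive x 1 (fun x => f x + g x) (df + dg).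
Proof. by move=> ? ?; exact: is_deriveD. Qed.

Lemma is_derive_subf f g x df dg : is_derive x 1 f df -> is_derive x 1 g dg ->
  is_derive x 1 (fun x => f x - g x) (df - dg).
Proof. by move=> ? ?; exact: is_deriveB. Qed.

Lemma is_derive_mulf f g x df dg : is_derive x 1 f df -> is_derive x 1 g dg ->
  is_derive x 1 (fun x => f x * g x) (df * g x + f x * dg).
Proof.
move=> dfx dgx; apply: (@is_derive_eq _ _ _ (f * g) x 1 _ _ (is_deriveM dfx dgx)).
by rewrite addrC /GRing.scale/= mulrC.
Qed.

Lemma is_derive_compf h f x dh df : is_derive (f x) 1 h dh ->
  is_derive x 1 f df -> is_derive x 1 (fun x => h (f x)) (dh * df).
Proof.
by move=> dhx dfx; exact: (is_derive1_comp dhx dfx).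
Qed.

Lemma is_derive_sub_from b x : is_derive x 1 (fun x => b - x) (-1).
Proof. by rewrite -[-1]add0r; apply: is_deriveB. Qed.

Lemma continuous_sqr_plus1 x : {for x, continuous (fun x : R => 1 + x ^+ 2)}.
Proof.
by apply: continuous_addf; [exact: cvg_cst|exact: exprn_continuous].
Qed.

Lemma sqr_plus1_gt0 x : 0 < 1 + x ^+ 2.
Proof. by rewrite ltr_pwDl ?ltr01 ?sqr_ge0. Qed.

Lemma sqr_plus1_neq0 x : 1 + x ^+ 2 != 0.
Proof. exact: lt0r_neq0 (sqr_plus1_gt0 x). Qed.

(* Away from the kink this is the chain rule; at the kink it is saved by
   [k 0 = 0]. *)
Lemma is_derive_pos_part (K k : R -> R) x :
  (forall v : R, is_derive v 1 K (k v)) -> k 0 = 0 ->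
  is_derive x 1 (fun v => K (Num.max v 0)) (k (Num.max x 0)).
Proof.
move=> dK k0; have [x0|x0|->] := ltgtP x 0.
- rewrite k0; apply: (@near_eq_is_derive _ _ _ (cst (K 0))).
  near=> v; rewrite max_r// ltW//.
  by near: v; exact: lt_nbhsl.
- apply: (@near_eq_is_derive _ _ _ K).
  near=> v; rewrite max_l// ltW//.
  by near: v; exact: lt_nbhsr.
- have /is_derive1_caratheodory[g [gE gc g0]] := dK 0.
  rewrite k0 in g0 *.
  (* The slope function of [K] at 0, precomposed with the positive part: for [v <= 0] it equals
     [g 0 = 0], as the constant left branch requires. *)
  apply/is_derive1_caratheodory; exists (fun v => g (Num.max v 0)); split.
  + move=> v; rewrite maxxx gE subr0; have [v0|v0] := leP v 0.
      by rewrite g0 !mul0r.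
    by rewrite !subr0.
  + apply: continuous_compf; first by rewrite maxxx.
    exact: continuous_pos_part.
  + by rewrite maxxx.
Unshelve. all: by end_near. Qed.

End PointwiseDerivatives.

Lemma ge_of_derive_ge {R : realType} (f df : R -> R) C s t : 0 <= s <= t ->
  continuous f -> (forall r : R, 0 < r -> is_derive r 1 f (df r)) ->
  (forall r, s < r < t -> C <= df r) ->
  f s + C * (t - s) <= f t.
Proof.
move=> st cf dfE dfC.
have cNf : continuous (fun r => 0 - f r).
  by move=> x; apply: continuous_subf; [exact: cvg_cst|exact: cf].
have := @le_of_derive_le R (fun r => 0 - f r) (fun r => 0 - df r) (- C) s t st cNf.
move=> /(_ _ _)/[!sub0r].
have H1 (r : R) : 0 < r -> is_derive r 1 (fun r => 0 - f r) (0 - df r).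
  by move=> /dfE dfr; exact: is_derive_subf (is_derive_cstf 0 r) dfr.
move=> /(_ H1) H; suff : - f t <= - f s + - C * (t - s) by lra.
by apply: H => r /dfC; rewrite sub0r lerN2.
Qed.

(** * Comparison principle *)

Section TestFunctions.
Context {R : realType}.
Implicit Types v x : R.

(** In the chain [kernel1'], [kernel1], [energy1], [energy2] each function is the derivative of the
    next, and all vanish at 0 and are nonnegative on [0, oo). Each of the last three serves as
    energy or test function; the bound [kernel1 <= 1] starts the iteration. *)
Definition kernel1 v : R := v ^+ 2 / (1 + v ^+ 2).
Definition kernel1' v : R := 2 * v / (1 + v ^+ 2) ^+ 2.
Definition energy1 v : R := v - atan v.
Definition energy2 v : R := (v ^+ 2 + ln (1 + v ^+ 2)) / 2 - v * atan v.

Lemma is_derive_sqr_plus1 v : is_derive v 1 (fun v => 1 + v ^+ 2) (2 * v).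
Proof.
apply: (@is_derive_eq _ _ _ ((cst 1 : R -> R) + id ^+ 2) v 1 _ _ _).
by rewrite add0r expr1 /GRing.scale/= mulr1 mulr_natl.
Qed.

Lemma is_derive_kernel1 v : is_derive v 1 kernel1 (kernel1' v).
Proof.
have E w : kernel1 w = 1 - (1 + w ^+ 2)^-1.
  by rewrite /kernel1; field; exact: sqr_plus1_neq0.
rewrite (funext E).
have dV := @is_deriveV _ (fun v => 1 + v ^+ 2) _ _ _ (sqr_plus1_neq0 v)
  (is_derive_sqr_plus1 v).
have := is_derive_subf (is_derive_cstf 1 v) dV.
move/is_derive_eq; apply.
rewrite /kernel1' /GRing.scale/=; field; exact: sqr_plus1_neq0.
Qed.

Lemma is_derive_energy1 v : is_derive v 1 energy1 (kernel1 v).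
Proof.
have := is_derive_subf (is_derive_id v (1 : R)) (is_derive1_atan v).
by move/is_derive_eq; apply; rewrite /kernel1; field; exact: sqr_plus1_neq0.
Qed.

Lemma is_derive_energy2 v : is_derive v 1 energy2 (energy1 v).
Proof.
have dsq : is_derive v 1 (fun v => v ^+ 2) (2 * v).
  have := is_derive_subf (is_derive_sqr_plus1 v) (is_derive_cstf 1 v).
  rewrite subr0; congr is_derive; apply/funext => w.
  by rewrite /cst addrC addKr.
have dln := is_derive_compf (f := fun v => 1 + v ^+ 2)
  (is_derive1_ln (sqr_plus1_gt0 v))
  (is_derive_sqr_plus1 v).
have := is_derive_subf
  (is_derive_mulf (is_derive_addf dsq dln) (is_derive_cstf (2^-1) v))
  (is_derive_mulf (is_derive_id v (1 : R)) (is_derive1_atan v)).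
by move/is_derive_eq; apply; rewrite /energy1 /cst; field; exact: sqr_plus1_neq0.
Qed.

Lemma kernel1_ge0 v : 0 <= kernel1 v.
Proof. by rewrite divr_ge0 ?sqr_ge0// ltW// sqr_plus1_gt0. Qed.

Lemma kernel1_le1 v : kernel1 v <= 1.
Proof. by rewrite ler_pdivrMr ?sqr_plus1_gt0// mul1r lerDr. Qed.

Lemma kernel1_0 : kernel1 0 = 0.
Proof. by rewrite /kernel1 expr0n mul0r. Qed.

Lemma kernel1'_0 : kernel1' 0 = 0.
Proof. by rewrite /kernel1' mulr0 mul0r. Qed.

Lemma kernel1'_ge0 v : 0 <= v -> 0 <= kernel1' v.
Proof. by move=> v0; rewrite divr_ge0 ?sqr_ge0// mulr_ge0. Qed.

Lemma continuous_kernel1' : continuous kernel1'.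
Proof.
move=> v.
have c2 : {for v, continuous (fun v : R => 2 * v)} by exact: mulrl_continuous.
have csq : {for 1 + v ^+ 2, continuous (fun w : R => w ^+ 2)}.
  exact: exprn_continuous.
have cd := @continuous_compf _ _ _ (fun v => 1 + v ^+ 2) v csq
  (continuous_sqr_plus1 (x := v)).
by apply: (continuous_divf c2 cd); rewrite expf_neq0// sqr_plus1_neq0.
Qed.

Lemma energy1_0 : energy1 0 = 0.
Proof. by rewrite /energy1 atan0 subrr. Qed.

Lemma energy2_0 : energy2 0 = 0.
Proof. by rewrite /energy2 expr0n addr0 ln1 mul0r addr0 mul0r subrr. Qed.

Lemma gt0_of_derive_gt0 (f df : R -> R) v :
  (forall w : R, is_derive w 1 f (df w)) -> f 0 = 0 ->
  (forall w, 0 < w -> 0 < df w) -> 0 < v -> 0 < f v.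
Proof.
move=> dfE f0 df0 v0; have [|c cv] := @MVT _ f df 0 v v0 (fun w _ => dfE w).
  by apply: continuous_subspaceT => w; exact: is_derive_continuous (dfE w).
rewrite f0 !subr0 => ->; rewrite mulr_gt0// df0//.
by move: cv; rewrite in_itv/= => /andP[].
Qed.

Lemma energy1_gt0 v : 0 < v -> 0 < energy1 v.
Proof.
apply: (gt0_of_derive_gt0 is_derive_energy1 energy1_0) => w w0.
by rewrite divr_gt0 ?exprn_gt0 ?sqr_plus1_gt0.
Qed.

Lemma energy2_gt0 v : 0 < v -> 0 < energy2 v.
Proof. exact: gt0_of_derive_gt0 is_derive_energy2 energy2_0 energy1_gt0. Qed.

Lemma energy1_ge0 v : 0 <= v -> 0 <= energy1 v.
Proof.
by rewrite le_eqVlt => /predU1P[<-|/energy1_gt0/ltW//]; rewrite energy1_0.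
Qed.

Lemma energy2_ge0 v : 0 <= v -> 0 <= energy2 v.
Proof.
by rewrite le_eqVlt => /predU1P[<-|/energy2_gt0/ltW//]; rewrite energy2_0.
Qed.

End TestFunctions.

(** [p] and [q] stand for [y_x] and [y_xx]. Continuity of [y] is asked on the whole plane, so that
    time 0 needs no one-sided notions; the equation itself concerns [t > 0]. *)
Definition csf_flow {R : realType} (y p q : R -> R -> R) : Prop :=
  (forall x t, jcontinuous_at y x t) /\
  forall x t : R, 0 < t ->
    [/\ is_derive x 1 (y ^~ t) (p x t),
        is_derive x 1 (p ^~ t) (q x t),
        is_derive t 1 (y x) (q x t / (1 + p x t ^+ 2)),
        jcontinuous_at p x t & jcontinuous_at q x t].

Section Flow.
Context {R : realType}.
Variables y p q : R -> R -> R.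
Hypothesis yF : csf_flow y p q.
Implicit Types (x t a b : R).

Lemma flow_continuous t : continuous (y ^~ t).
Proof. by move=> x; exact: jcontinuous_fst (yF.1 x t). Qed.

Lemma flow_continuous_p t : 0 < t -> continuous (p ^~ t).
Proof.
by move=> t0 x; have [_ _ _ cp _] := yF.2 x t t0; exact: jcontinuous_fst cp.
Qed.

Lemma flow_continuous_atan t : 0 < t -> continuous (fun x => atan (p x t)).
Proof.
move=> t0 x; apply: (continuous_compf (h := atan)); first exact: continuous_atan.
exact: flow_continuous_p.
Qed.

(** The divergence form of the equation: the right-hand side is the spatial derivative of the
    bounded flux [atan y_x]. *)
Lemma flow_is_derive_atan x t : 0 < t ->
  is_derive x 1 (fun x => atan (p x t)) (q x t / (1 + p x t ^+ 2)).
Proof.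
move=> t0; have [_ dp _ _ _] := yF.2 x t t0; rewrite mulrC.
exact: is_derive_compf.
Qed.

Lemma flow_jcontinuous_dt x t : 0 < t ->
  jcontinuous_at (fun x t => q x t / (1 + p x t ^+ 2)) x t.
Proof.
move=> t0; have [_ _ _ cp cq] := yF.2 x t t0.
apply: continuous_divf => //; last exact: sqr_plus1_neq0.
apply: (@continuous_compf _ _ (fun v => 1 + v ^+ 2) _ (x, t)) => //.
exact: continuous_sqr_plus1.
Qed.

Lemma flow_continuous_dt t : 0 < t ->
  continuous (fun x => q x t / (1 + p x t ^+ 2)).
Proof.
by move=> t0 x; exact: (jcontinuous_fst (flow_jcontinuous_dt t0)).
Qed.

End Flow.

(** * Energy estimates for the difference of two flows *)

Section Comparison.
Context {R : realType}.
Variables y1 p1 q1 y2 p2 q2 : R -> R -> R.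
Hypotheses (F1 : csf_flow y1 p1 q1) (F2 : csf_flow y2 p2 q2).
Variable c : R.
Hypothesis yc : forall t : R, 0 < t -> y1 c t = y2 c t.
Hypothesis y0 : forall x, c <= x -> y1 x 0 <= y2 x 0.
Implicit Types (b x t : R).

(** [u] is the difference of the solutions and [v] that of their fluxes; [dv] is at once [u_t] and
    [v_x]. *)
Let u x t : R := y1 x t - y2 x t.
Let v x t : R := atan (p1 x t) - atan (p2 x t).
Let dv x t : R := q1 x t / (1 + p1 x t ^+ 2) - q2 x t / (1 + p2 x t ^+ 2).

Let u_jcont x t : jcontinuous_at u x t.
Proof. by apply: continuous_subf; [exact: F1.1|exact: F2.1]. Qed.

Let u_cont t : continuous (u ^~ t).
Proof. by move=> x; exact: (jcontinuous_fst (F := u) (@u_jcont x t)). Qed.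

Let u_dx x t : 0 < t -> is_derive x 1 (u ^~ t) (p1 x t - p2 x t).
Proof.
move=> t0; have [d1 _ _ _ _] := F1.2 x t t0.
by have [d2 _ _ _ _] := F2.2 x t t0; exact: is_derive_subf.
Qed.

Let u_dt x t : 0 < t -> is_derive t 1 (u x) (dv x t).
Proof.
move=> t0; have [_ _ d1 _ _] := F1.2 x t t0.
by have [_ _ d2 _ _] := F2.2 x t t0; exact: is_derive_subf.
Qed.

Let v_dx x t : 0 < t -> is_derive x 1 (v ^~ t) (dv x t).
Proof.
move=> t0; apply: is_derive_subf.
  exact: (flow_is_derive_atan F1).
exact: (flow_is_derive_atan F2).
Qed.

Let dv_jcont x t : 0 < t -> jcontinuous_at dv x t.
Proof.
move=> t0; apply: continuous_subf.
  exact: (flow_jcontinuous_dt F1).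
exact: (flow_jcontinuous_dt F2).
Qed.

Let v_le_pi x t : v x t <= pi.
Proof.
have := atan_ltpi2 (p1 x t); have := atan_gtNpi2 (p2 x t).
by rewrite /v; lra.
Qed.

Let v_mono x t : 0 <= (p1 x t - p2 x t) * v x t.
Proof.
rewrite /v; have [p12|p21] := leP (p1 x t) (p2 x t).
  by rewrite mulr_le0// subr_le0//; exact: le_atan.
by rewrite mulr_ge0// subr_ge0; [exact: ltW|exact/le_atan/ltW].
Qed.

Section Energy.
Variables H h h' : R -> R.
Hypotheses (dH : forall w : R, is_derive w 1 H (h w))
  (dh : forall w : R, is_derive w 1 h (h' w)) (ch' : continuous h')
  (h0 : forall w : R, w <= 0 -> h w = 0) (H0 : forall w : R, w <= 0 -> H w = 0)
  (h_ge0 : forall w, 0 <= h w) (h'_ge0 : forall w, 0 <= h' w).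

(* Testing the equation for u with h(u)(b - x): no information on the solutions
   at x = b enters, because the test function vanishes there and the flux is
   bounded by pi. *)
Lemma energy_bound b t K : c <= b -> 0 < t ->
  (forall s : R, 0 < s <= t -> integral_on c b (fun x => h (u x s)) <= K) ->
  integral_on c b (fun x => H (u x t) * (b - x)) <= pi * K * t.
Proof.
move=> cb t0 hK.
have cH w : {for w, continuous H} by exact: is_derive_continuous (dH w).
have ch w : {for w, continuous h} by exact: is_derive_continuous (dh w).
have cbx : continuous (fun x => b - x).
  by move=> x; apply: continuous_subf; [exact: cvg_cst|exact: cvg_id].
pose F x s : R := H (u x s) * (b - x).
pose G x s : R := (h (u x s) * dv x s) * (b - x).
have cF x s : jcontinuous_at F x s.
  apply: continuous_mulf.
    by apply: (continuous_compf (h := H)) => //; exact: u_jcont.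
  exact: (jcontinuous_of_fst (cbx x)).
have cG x (s : R) : 0 < s -> jcontinuous_at G x s.
  move=> s0; apply: continuous_mulf; last first.
    exact: (jcontinuous_of_fst (cbx x)).
  apply: continuous_mulf; last exact: dv_jcont.
  by apply: (continuous_compf (h := h)) => //; exact: u_jcont.
have cFs s : continuous (F ^~ s).
  by move=> x; exact: (jcontinuous_fst (F := F) (cF x s)).
have dF x (s : R) : 0 < s -> is_derive s 1 (F x) (G x s).
  move=> s0.
  have := is_derive_mulf (is_derive_compf (dH _) (u_dt x s0))
    (is_derive_cstf (b - x) s).
  by rewrite mulr0 addr0.
have /= := @le_of_derive_le R _ _ (pi * K) 0 t _
  (continuous_integral_on (a := c) (b := b) cF)
  (fun s s0 => is_derive_integral_on c b s0 cFs dF cG).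
rewrite lexx (ltW t0) => /(_ isT).
rewrite [X in _ <= X + _](_ : _ = 0); last first.
  rewrite (@eq_integral_on _ _ _ _ (fun=> 0)).
    by rewrite integral_on_cst// mul0r.
  by move=> x /andP[cx _]; rewrite /F H0 ?mul0r// subr_le0 y0.
rewrite add0r subr0; apply=> s /andP[s0 st].
(* [f] is the spatial derivative of [h(u) v (b - x)], which vanishes at [c] because [u] does and at
   [b] because of the weight. So [f] has integral 0; its first term is nonnegative, and [G] is at
   most [f + pi h(u)]. *)
pose f x : R := h' (u x s) * ((p1 x s - p2 x s) * v x s) * (b - x) + G x s
  - h (u x s) * v x s.
have chu : continuous (fun x => h (u x s)).
  by move=> x; exact: (continuous_compf (f := u ^~ s) (@ch _) (@u_cont s x)).
have cv : continuous (v ^~ s).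
  by move=> x; exact: is_derive_continuous (v_dx x s0).
have cGs : continuous (G ^~ s).
  by move=> x; exact: (jcontinuous_fst (F := G) (cG x s s0)).
have cp12 : continuous (fun x => p1 x s - p2 x s).
  move=> x; apply: continuous_subf.
    exact: (flow_continuous_p F1).
  exact: (flow_continuous_p F2).
have ch'u : continuous (fun x => h' (u x s)).
  by move=> x; exact: (continuous_compf (f := u ^~ s) (@ch' _) (@u_cont s x)).
have cf : continuous f.
  move=> x; exact: (continuous_subf (continuous_addf (continuous_mulf
    (continuous_mulf (ch'u x) (continuous_mulf (cp12 x) (cv x))) (cbx x)) (cGs x))
    (continuous_mulf (chu x) (cv x))).
have df x : c <= x <= b ->
    is_derive x 1 (fun x => h (u x s) * v x s * (b - x)) (f x).
  move=> _; have := is_derive_mulf (is_derive_mulf (is_derive_compf (dh _)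
    (u_dx x s0)) (v_dx x s0)) (is_derive_sub_from b x).
  by move/is_derive_eq; apply; rewrite /f /G; ring.
have If : integral_on c b f = 0.
  rewrite (integral_on_derive cb cf df) subrr mulr0.
  by rewrite h0 ?mul0r ?subrr// /u yc// subrr.
have cpih : continuous (fun x => pi * h (u x s)).
  by move=> x; exact: (continuous_scalef (chu x)).
apply: (@le_trans _ _ (integral_on c b (fun x => f x + pi * h (u x s)))).
  apply: le_integral_on => //.
    by move=> x; exact: (continuous_addf (cf x) (cpih x)).
  move=> x /andP[cx xb]; rewrite /f.
  have : 0 <= h' (u x s) * ((p1 x s - p2 x s) * v x s) * (b - x).
    by rewrite mulr_ge0 ?subr_ge0// mulr_ge0.
  have : h (u x s) * v x s <= pi * h (u x s) by rewrite mulrC ler_wpM2r.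
  lra.
rewrite integral_on_add// If add0r integral_onZ// ler_wpM2l ?pi_ge0//.
by apply: hK; rewrite s0 ltW.
Qed.

End Energy.

Let pos w : R := Num.max w 0.

Let pos_ge0 w : 0 <= pos w.
Proof. by rewrite /pos le_max lexx orbT. Qed.

Let pos_le0 w : w <= 0 -> pos w = 0.
Proof. by move=> w0; rewrite /pos max_r. Qed.

Let u_cont_pos (h : R -> R) t : continuous h ->
  continuous (fun x => h (pos (u x t))).
Proof.
move=> ch x; have cp := continuous_compf (f := u ^~ t)
  (@continuous_pos_part R _) (@u_cont t x).
exact: (continuous_compf (f := fun x => pos (u x t)) (ch _) cp).
Qed.

Let energy1_cont : continuous (@energy1 R).
Proof. by move=> w; exact: is_derive_continuous (is_derive_energy1 w). Qed.

Let energy2_cont : continuous (@energy2 R).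
Proof. by move=> w; exact: is_derive_continuous (is_derive_energy2 w). Qed.

Let kernel1_cont : continuous (@kernel1 R).
Proof. by move=> w; exact: is_derive_continuous (is_derive_kernel1 w). Qed.

Let linear_cont b : continuous (fun x : R => b - x).
Proof. by move=> x; exact: is_derive_continuous (is_derive_sub_from b x). Qed.

(** The energy estimate on the interval [c, b'] of twice the length, with [K = b' - c] because
    [kernel1 <= 1]. On [c, b] the weight [b' - x] is at least [b - c]; dividing by it removes the
    dependence on [b]. *)
Lemma energy1_bound b t : c < b -> 0 < t ->
  integral_on c b (fun x => energy1 (pos (u x t))) <= 2 * pi * t.
Proof.
move=> cb t0; pose b' := 2 * b - c.
have cb' : c <= b' by rewrite /b'; lra.
have := @energy_bound (fun w => energy1 (pos w)) (fun w => kernel1 (pos w))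
  (fun w => kernel1' (pos w)).
move=> /(_ _ _ _ _ _ _ _ b' t (b' - c)) E.
have {E} : integral_on c b' (fun x => energy1 (pos (u x t)) * (b' - x)) <=
    pi * (b' - c) * t.
  apply: E => //.
  - by move=> w; exact: (is_derive_pos_part _ is_derive_energy1 kernel1_0).
  - by move=> w; exact: (is_derive_pos_part _ is_derive_kernel1 kernel1'_0).
  - move=> w; exact: (continuous_compf (@continuous_kernel1' R _)
      (@continuous_pos_part R w)).
  - by move=> w /pos_le0 ->; exact: kernel1_0.
  - by move=> w /pos_le0 ->; exact: energy1_0.
  - by move=> w; exact: kernel1_ge0.
  - by move=> w; exact: kernel1'_ge0.
  - move=> s _; rewrite -[leRHS]mul1r -integral_on_cst//.
    apply: le_integral_on; first exact: (@u_cont_pos kernel1).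
      by move=> ?; exact: cvg_cst.
    by move=> x _; exact: kernel1_le1.
have cF : continuous (fun x => energy1 (pos (u x t)) * (b' - x)).
  move=> x; exact: (continuous_mulf (@u_cont_pos energy1 t energy1_cont x)
    (@linear_cont b' x)).
rewrite (@integral_on_cat _ b)//; last 2 first.
  exact: ltW.
  by rewrite /b'; lra.
have : 0 <= integral_on b b' (fun x => energy1 (pos (u x t)) * (b' - x)).
  apply: integral_on_ge0 => x /andP[_ xb]; apply: mulr_ge0.
    exact/energy1_ge0/pos_ge0.
  by rewrite subr_ge0.
have : (b - c) * integral_on c b (fun x => energy1 (pos (u x t))) <=
    integral_on c b (fun x => energy1 (pos (u x t)) * (b' - x)).
  rewrite -integral_onZ; last exact: (@u_cont_pos energy1).
  apply: le_integral_on => //.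
    by move=> x; exact: (continuous_scalef (@u_cont_pos energy1 t energy1_cont x)).
  move=> x /andP[_ xb]; rewrite mulrC ler_wpM2l//; first exact/energy1_ge0/pos_ge0.
  by rewrite /b'; lra.
have -> : pi * (b' - c) * t = (b - c) * (2 * pi * t) by rewrite /b'; ring.
set I1 := integral_on _ _ _; set I2 := integral_on _ _ _.
set I3 := integral_on _ _ _ => H1 H2 H3.
by rewrite -(@ler_pM2l _ (b - c)) ?subr_gt0//; lra.
Qed.

(** A second round, now with [energy1] as test function: the previous bound supplies
    [K = 2 pi t]. *)
Lemma energy2_bound b t : c < b -> 0 < t ->
  integral_on c b (fun x => energy2 (pos (u x t)) * (b - x)) <=
    pi * (2 * pi * t) * t.
Proof.
move=> cb t0.
have := @energy_bound (fun w => energy2 (pos w)) (fun w => energy1 (pos w))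
  (fun w => kernel1 (pos w)).
move=> /(_ _ _ _ _ _ _ _ b t (2 * pi * t)); apply => //.
- by move=> w; exact: (is_derive_pos_part _ is_derive_energy2 energy1_0).
- by move=> w; exact: (is_derive_pos_part _ is_derive_energy1 kernel1_0).
- move=> w; exact: (continuous_compf (@kernel1_cont _) (@continuous_pos_part R w)).
- by move=> w /pos_le0 ->; exact: energy1_0.
- by move=> w /pos_le0 ->; exact: energy2_0.
- by move=> w; exact: energy1_ge0.
- by move=> w; exact: kernel1_ge0.
- exact: ltW.
- move=> s /andP[s0 st]; apply: le_trans (energy1_bound cb s0) _.
  by rewrite ler_wpM2l// mulr_ge0// pi_ge0.
Qed.

(* The bound of [energy2_bound] does not depend on b, while its left-hand side
   grows linearly in b as soon as u is positive somewhere. *)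
Lemma comparison x t : c <= x -> 0 < t -> y1 x t <= y2 x t.
Proof.
move=> cx t0; rewrite leNgt; apply/negP => y21.
have ux : 0 < u x t by rewrite subr_gt0.
pose J z := energy2 (pos (u z t)).
have cJ : continuous J by exact: (@u_cont_pos energy2).
have J0 z : 0 <= J z by exact/energy2_ge0/pos_ge0.
have Jx : 0 < J x.
  by rewrite /J; apply: energy2_gt0; rewrite /pos lt_max ux.
have [e /= e0 He] : \forall z \near x, J x / 2 < J z.
  by apply: (cvgr_gt (J x) (cJ x)); lra.
have Je z : x <= z <= x + e / 2 -> J x / 2 <= J z.
  move=> /andP[xz ze]; apply/ltW/He => /=.
  by rewrite distrC ger0_norm ?subr_ge0//; lra.
pose k := e / 2 * (J x / 2).
have k0 : 0 < k by rewrite mulr_gt0// divr_gt0.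
pose T := pi * (2 * pi * t) * t.
have T0 : 0 <= T by rewrite !mulr_ge0 ?pi_ge0 ?ltW.
(* On [x, x + e / 2] the weight [b - z] is then at least [T / k + 1], so this piece alone
   contributes at least [k (T / k + 1) = T + k], which exceeds the bound [T]. *)
pose b := x + e / 2 + (T / k + 1).
have Tk : 0 <= T / k by rewrite divr_ge0// ltW.
have cb : c < b by rewrite /b; lra.
have := energy2_bound cb t0; rewrite -/T.
have cJb : continuous (fun x => J x * (b - x)).
  by move=> z; exact: (continuous_mulf (@cJ z) (@linear_cont b z)).
have xe : x <= x + e / 2 by lra.
have eb : x + e / 2 <= b by rewrite /b; lra.
rewrite (@integral_on_cat _ x)//; last by rewrite (le_trans xe).
rewrite (@integral_on_cat _ (x + e / 2) x b)//.
have I1 : 0 <= integral_on c x (fun x => J x * (b - x)).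
  apply: integral_on_ge0 => z /andP[_ zx]; apply: mulr_ge0 => //; rewrite subr_ge0.
  by rewrite (le_trans zx)// (le_trans xe).
have I3 : 0 <= integral_on (x + e / 2) b (fun x => J x * (b - x)).
  apply: integral_on_ge0 => z /andP[_ zb]; apply: mulr_ge0 => //.
  by rewrite subr_ge0.
have I2 : (J x / 2 * (T / k + 1)) * (e / 2) <=
    integral_on x (x + e / 2) (fun x => J x * (b - x)).
  have -> : (J x / 2 * (T / k + 1)) * (e / 2) =
      integral_on x (x + e / 2) (fun=> J x / 2 * (T / k + 1)).
    by rewrite integral_on_cst// addrAC subrr add0r.
  apply: le_integral_on => //; first by move=> ?; exact: cvg_cst.
  move=> z /andP[xz ze]; apply: ler_pM.
  - by rewrite divr_ge0// ltW.
  - by lra.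
  - by apply: Je; rewrite xz.
  - by rewrite /b; lra.
have E : (J x / 2 * (T / k + 1)) * (e / 2) = T + k.
  have -> : (J x / 2 * (T / k + 1)) * (e / 2) = k * (T / k + 1).
    by rewrite /k; ring.
  by rewrite mulrDr mulr1 mulrC divfK// gt_eqF.
rewrite E in I2; move: I1 I2 I3.
rewrite /J; set A := integral_on _ _ _; set B := integral_on _ _ _.
set C := integral_on _ _ _; lra.
Qed.

End Comparison.

(** * Solutions and reflections *)

Section Solutions.
Context {R : realType}.
Implicit Types (x t c k : R) (y p q : R -> R -> R).

Lemma is_derive_derive1 (f : R -> R) x : derivable f x 1 ->
  is_derive x 1 f (derive1 f x).
Proof. by rewrite derive1E; exact: derivableP. Qed.

(** Freezing the solution at its initial values for negative times turns continuity within the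
    closed half-plane into joint continuity on the whole plane. *)
Lemma flow_of_solution (y0 : R -> R) y : Ecker_Huisken_solution y0 y ->
  csf_flow (fun x t => y x (Num.max t 0)) (dx y) (dx (dx y)).
Proof.
move=> [cy _ _ smooth pde]; split.
  move=> x t; pose A := [set z : R * R | 0 <= z.2].
  have mA : A (x, Num.max t 0) by rewrite /A /= le_max lexx orbT.
  have /subspace_continuousP/(_ _ mA) cyx := cy.
  pose phi (z : R * R) := (z.1, Num.max z.2 0).
  have cphi : phi z @[z --> (x, t)] --> within A (nbhs (x, Num.max t 0)).
    have cphi0 : {for (x, t), continuous phi}.
      apply: (@cvg_pair _ R R (nbhs (x, t)) (nbhs x) (nbhs (Num.max t 0))).
        exact: cvg_fst.
      apply: (@continuous_compf R _ (fun v => Num.max v 0) snd (x, t)).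
        exact: continuous_pos_part.
      exact: cvg_snd.
    move=> U /cphi0.
    apply: (@filterS _ (nbhs (x, t)) _ (fun z => A (phi z) -> U (phi z))).
    by move=> z; apply; rewrite /A /phi/= le_max lexx orbT.
  have cy_phi := cvg_comp _ _ cphi cyx.
  exact: cy_phi.
move=> x t t0; have [_ [D2 C1x _]] := smooth 2%N.
have [cp [D1 [cq _] _]] := C1x.
have {D2}[y_x y_t] := D2 (x, t) t0; have {D1}[p_x _] := D1 (x, t) t0.
split.
- have E : (fun x => y x (Num.max t 0)) = y ^~ t.
    by apply/funext => z; rewrite max_l// ltW.
  by rewrite E; exact: is_derive_derive1 y_x.
- exact: is_derive_derive1 p_x.
- apply: (@near_eq_is_derive _ _ _ (y x)).
    near=> s; rewrite max_l// ltW//.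
    by near: s; exact: lt_nbhsr.
  by rewrite -pde//; exact: is_derive_derive1 y_t.
- exact: (cp (x, t)).
- exact: (cq (x, t)).
Unshelve. all: by end_near. Qed.

Lemma jcontinuous_reflect (F : R -> R -> R) k x t :
  jcontinuous_at F (k - x) t -> jcontinuous_at (fun x t => F (k - x) t) x t.
Proof.
move=> cF; pose phi (z : R * R) := (k - z.1, z.2).
have cphi : {for (x, t), continuous phi}.
  apply: (@cvg_pair _ R R (nbhs (x, t)) (nbhs (k - x)) (nbhs t)).
    apply: (jcontinuous_of_fst (f := fun x => k - x)).
    exact: is_derive_continuous (is_derive_sub_from k x).
  exact: cvg_snd.
exact: (continuous_comp cphi cF).
Qed.

(** Under [x |-> k - x] the slope changes sign, but [q] and [p ^ 2], the only quantities in the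
    equation, do not. *)
Lemma flow_reflect y p q k : csf_flow y p q ->
  csf_flow (fun x t => y (k - x) t) (fun x t => - p (k - x) t)
    (fun x t => q (k - x) t).
Proof.
move=> [cy D]; split.
  by move=> x t; exact: (jcontinuous_reflect (F := y) (cy _ _)).
move=> x t t0; have [y_x p_x y_t cp cq] := D (k - x) t t0; split.
- have := is_derive_compf (f := fun x => k - x) y_x (is_derive_sub_from k x).
  by rewrite mulrN1.
- have := is_derive_subf (is_derive_cstf 0 x)
    (is_derive_compf (f := fun x => k - x) p_x (is_derive_sub_from k x)).
  rewrite mulrN1 sub0r opprK; congr is_derive.
  by apply/funext => z; rewrite sub0r.
- by rewrite sqrrN.
- have := jcontinuous_reflect cp; exact: cvgN.
- exact: (jcontinuous_reflect (F := q) cq).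
Qed.

Lemma derive_le0_of_right_le (g : R -> R) c dg : is_derive c 1 g dg ->
  (forall x, c <= x -> g x <= g c) -> dg <= 0.
Proof.
move=> /is_derive1_caratheodory[h [hE ch <-]] gc; rewrite leNgt; apply/negP => h0.
have [e /= e0 He] : \forall z \near c, 0 < h z by exact: (cvgr_gt (h c) ch).
have ce : c <= c + e / 2 by lra.
have := gc _ ce; rewrite -subr_le0 hE leNgt => /negP; apply.
rewrite addrAC subrr add0r mulr_gt0 ?divr_gt0// He//=.
by rewrite opprD addrA subrr sub0r normrN ger0_norm; lra.
Qed.

(* Alexandrov reflection about c. *)
Lemma flow_slope_le0 y p q c t : csf_flow y p q -> 0 < t ->
  (forall x, c <= x -> y x 0 <= y (2 * c - x) 0) -> p c t <= 0.
Proof.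
move=> yF t0 y0; have rF := flow_reflect (2 * c) yF.
have c2 : 2 * c - c = c by ring.
have cmp x : c <= x -> y x t <= y (2 * c - x) t.
  move=> cx; have := comparison (c := c) yF rF; apply => //.
  by move=> s _; rewrite c2.
have [y_x _ _ _ _] := yF.2 c t t0; have [r_x _ _ _ _] := rF.2 c t t0.
(* The difference between [y] and its reflection is at most 0 right of [c] and vanishes at [c]; its
   slope there is [2 p(c, t)]. *)
have : p c t - - p (2 * c - c) t <= 0.
  apply: (derive_le0_of_right_le (is_derive_subf y_x r_x)) => x cx.
  by rewrite c2 subrr subr_le0 cmp.
by rewrite c2; lra.
Qed.

End Solutions.

(** * Decay of the spike *)

Section ArctanTail.
Context {R : realType}.
Implicit Types z N : R.

Lemma atan_inv_mono z N : 0 <= z -> 0 <= N ->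
  atan z + (1 + z)^-1 <= atan (z + N) + (1 + (z + N))^-1.
Proof.
move=> z0 N0.
pose df (v : R) := (1 + v ^+ 2)^-1 - (1 + v) ^- 2.
have dfE (v : R) : 0 <= v -> is_derive v 1 (fun v => atan v + (1 + v)^-1) (df v).
  move=> v0; have v1 : 1 + v != 0 by rewrite lt0r_neq0// ltr_pwDl.
  have d1 : is_derive v 1 (fun v : R => 1 + v) 1.
    have := is_derive_addf (is_derive_cstf 1 v) (is_derive_id v (1 : R)).
    by rewrite add0r.
  have := is_derive_addf (is_derive1_atan v)
    (@is_deriveV _ (fun v => 1 + v) _ _ _ v1 d1).
  by rewrite /df /GRing.scale/= mulr1.
have zN : z <= z + N by rewrite lerDl.
have [||c cz E] := @MVT_segment R (fun v => atan v + (1 + v)^-1) df z (z + N) zN.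
- move=> v; rewrite in_itv/= => /andP[zv _]; apply: dfE.
  by rewrite (le_trans z0)// ltW.
- apply: continuous_in_subspaceT => v; rewrite inE/= in_itv/= => /andP[zv _].
  exact: is_derive_continuous (dfE v (le_trans z0 zv)).
rewrite -subr_ge0 E mulr_ge0//; last by rewrite addrAC subrr add0r.
have c0 : 0 <= c by move: cz; rewrite in_itv/= => /andP[/(le_trans z0)].
rewrite /df subr_ge0 lef_pV2 ?posrE ?sqr_plus1_gt0//.
  by rewrite sqrrD expr1n mul1r -addrA lerD2l lerDr mulrn_wge0.
by rewrite exprn_gt0// ltr_pwDl.
Qed.

(** The function [atan z + 1 / (1 + z)] is nondecreasing with limit pi / 2. The limit is avoided: if
    the inequality failed by [d > 0], the value at [z + 1 / d] would already be below [pi / 2 + d],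
    the value at [z]. *)
Lemma inv_le_atan_compl z : 0 <= z -> (1 + z)^-1 <= pi / 2 - atan z.
Proof.
move=> z0; rewrite leNgt; apply/negP => H.
pose d := (1 + z)^-1 - (pi / 2 - atan z).
have d0 : 0 < d by rewrite subr_gt0.
have N0 : 0 <= d^-1 by rewrite invr_ge0 ltW.
have := atan_inv_mono z0 N0; have := atan_ltpi2 (z + d^-1).
have : (1 + (z + d^-1))^-1 <= d.
  rewrite -[leRHS]invrK lef_pV2 ?posrE ?invr_gt0//; last first.
    by rewrite ltr_pwDl// addr_ge0.
  by rewrite addrA lerDr addr_ge0.
by rewrite /d; lra.
Qed.

(* The tangent lines of the convex function v |-> 1 / v bound cot from below:
   -s = cot (pi / 2 + atan s) >= 1 / (pi / 2 + atan s) - 1. *)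
Lemma atan_tangent (l s : R) : s <= 0 ->
  2 * l - 1 + s - pi / 2 * l ^+ 2 <= l ^+ 2 * atan s.
Proof.
move=> s0; have z0 : 0 <= - s by rewrite oppr_ge0.
have := inv_le_atan_compl z0; rewrite atanN opprK => H.
have s1 : 0 < 1 - s by lra.
have : 2 * l - (1 - s) <= l ^+ 2 * (1 - s)^-1.
  rewrite ler_pdivlMr// -subr_ge0.
  have -> : l ^+ 2 - (2 * l - (1 - s)) * (1 - s) = (l - (1 - s)) ^+ 2 by ring.
  exact: sqr_ge0.
have : l ^+ 2 * (1 - s)^-1 <= l ^+ 2 * (pi / 2 + atan s).
  by rewrite ler_wpM2l// sqr_ge0.
by lra.
Qed.

End ArctanTail.

(** * Area and flux *)

Section AreaBalance.
Context {R : realType}.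
Variables y p q : R -> R -> R.
Hypothesis yF : csf_flow y p q.
Implicit Types (x a b s t : R).

Lemma flow_area_continuous a b : continuous (fun t => integral_on a b (y ^~ t)).
Proof. exact: (continuous_integral_on (F := y) yF.1). Qed.

(** Area changes only through the flux at the two endpoints. *)
Lemma flow_area_derive a b t : a <= b -> 0 < t ->
  is_derive t 1 (fun t => integral_on a b (y ^~ t))
    (atan (p b t) - atan (p a t)).
Proof.
move=> ab t0; pose G x s : R := q x s / (1 + p x s ^+ 2).
have y_t x (s : R) : 0 < s -> is_derive s 1 (y x) (G x s).
  by move=> s0; have [] := yF.2 x s s0.
have cG x (s : R) : 0 < s -> jcontinuous_at G x s.
  by move=> s0; exact: (flow_jcontinuous_dt yF).
have := is_derive_integral_on a b t0 (flow_continuous yF) y_t cG.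
congr is_derive.
apply: (integral_on_derive (F := fun x => atan (p x t))) => //.
  exact: (flow_continuous_dt yF).
by move=> x _; exact: (flow_is_derive_atan yF).
Qed.

Hypothesis p_le0 : forall x t, 0 <= x -> 0 < t -> p x t <= 0.

Lemma flow_decreasing a b t : 0 < t -> 0 <= a <= b -> y b t <= y a t.
Proof.
move=> t0 ab; have := @le_of_derive_le R (y ^~ t) (p ^~ t) 0 a b ab.
rewrite mul0r addr0; apply.
- exact: flow_continuous yF t.
- by move=> x _; have [] := yF.2 x t t0.
- move=> x /andP[ax _]; apply: p_le0 => //.
  by move: ab => /andP[a0 _]; rewrite (le_trans a0)// ltW.
Qed.

Let atan_le0 x t : 0 <= x -> 0 < t -> atan (p x t) <= 0.
Proof. by move=> x0 t0; rewrite -(@atan0 R) le_atan// p_le0. Qed.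

(** On [x >= 0] the flux lies in (-pi / 2, 0], so the area over any interval there falls at rate at
    most pi / 2. *)
Lemma flow_area_ge a b s t : 0 <= a <= b -> 0 <= s <= t ->
  integral_on a b (y ^~ s) - pi / 2 * (t - s) <= integral_on a b (y ^~ t).
Proof.
move=> /andP[a0 ab] st; rewrite -mulNr.
have := @ge_of_derive_ge R _ _ (- (pi / 2)) s t st (@flow_area_continuous a b)
  (fun r r0 => flow_area_derive ab r0).
apply=> r /andP[sr _]; have r0 : 0 < r by case/andP: st => /le_lt_trans ->.
have := atan_le0 a0 r0; have := atan_gtNpi2 (p b r).
by lra.
Qed.

Lemma flow_area_le a b t : 0 <= a <= b -> 0 < t ->
  integral_on a b (y ^~ t) <= integral_on a b (y ^~ 0) + pi / 2 * t.
Proof.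
move=> /andP[a0 ab] t0.
have t00 : (0 : R) <= 0 <= t by rewrite lexx ltW.
have := @le_of_derive_le R _ _ (pi / 2) 0 t t00 (@flow_area_continuous a b)
  (fun r r0 => flow_area_derive ab r0).
rewrite subr0; apply=> r /andP[r0 _].
have := atan_le0 (le_trans a0 ab) r0; have := atan_gtNpi2 (p a r).
by lra.
Qed.

(** * Estimates around a narrow spike of bounded height *)

Section Spike.
Variables A0 w t0 M : R.
Hypotheses (w_gt0 : 0 < w) (y00 : forall x, w <= x -> y x 0 = 0)
  (area0 : integral_on 0 w (y ^~ 0) = A0 / 2)
  (t0_gt0 : 0 < t0) (t0_le : pi * t0 <= A0)
  (M_gt0 : 0 < M) (yM : y 0 t0 <= M).

Let area0_ge a b : w <= a -> a <= b -> integral_on a b (y ^~ 0) = 0.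
Proof.
move=> wa ab; rewrite (@eq_integral_on _ _ _ _ (fun=> 0)).
  by rewrite integral_on_cst// mul0r.
by move=> x /andP[ax _]; rewrite y00// (le_trans wa).
Qed.

Let area0_cat a : w <= a -> integral_on 0 a (y ^~ 0) = A0 / 2.
Proof.
move=> wa; rewrite (@integral_on_cat _ w)//; last 2 first.
  exact: flow_continuous yF 0.
  exact: ltW.
by rewrite area0 area0_ge// addr0.
Qed.

Let y_cont t : continuous (y ^~ t). Proof. exact: flow_continuous yF t. Qed.

Let y_le_M x : 0 <= x -> y x t0 <= M.
Proof. by move=> x0; apply: le_trans yM; apply: flow_decreasing; rewrite ?lexx. Qed.

Let y_ge_avg a b t : 0 < t -> 0 <= a <= b ->
  y b t * (b - a) <= integral_on a b (y ^~ t).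
Proof.
move=> t_gt0 /andP[a0 ab]; rewrite -integral_on_cst//.
apply: le_integral_on => //; first by move=> ?; exact: cvg_cst.
by move=> x /andP[ax xb]; apply: flow_decreasing => //; rewrite (le_trans a0).
Qed.

(** At time [s] the area on [0, 2w] is at most [2 w M + pi / 2 (t0 - s)], looking back from [t0].
    That on [0, w] is at least [A0 / 2 - pi / 2 s], hence at least [pi / 2 (t0 - s)] because
    [pi t0 <= A0]. So [w, 2w] holds area at most [2 w M], and monotonicity in [x] bounds the value
    at [2w]. *)
Lemma spike_outer_le s : 0 < s <= t0 -> y (2 * w) s <= 2 * M.
Proof.
move=> /andP[s0 st]; have w0 := ltW w_gt0.
have w2 : 0 <= 2 * w by rewrite mulr_ge0.
have ww2 : w <= 2 * w by lra.
have H1 : integral_on 0 (2 * w) (y ^~ t0) <= M * (2 * w).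
  rewrite -[2 * w in leRHS]subr0 -integral_on_cst//.
  apply: le_integral_on => //; first by move=> ?; exact: cvg_cst.
  by move=> x /andP[x0 _]; exact: y_le_M.
have H2 : integral_on 0 (2 * w) (y ^~ s) - pi / 2 * (t0 - s) <=
    integral_on 0 (2 * w) (y ^~ t0).
  by apply: flow_area_ge; [rewrite lexx w2|rewrite ltW].
have H3 : A0 / 2 - pi / 2 * s <= integral_on 0 w (y ^~ s).
  rewrite -area0; have := @flow_area_ge 0 w 0 s; rewrite subr0; apply.
    by rewrite lexx w0.
  by rewrite lexx ltW.
rewrite (@integral_on_cat _ w 0 (2 * w)) in H2 => //.
have H4 : y (2 * w) s * (2 * w - w) <= integral_on w (2 * w) (y ^~ s).
  by apply: y_ge_avg => //; rewrite w0.
have : w * y (2 * w) s <= w * (2 * M) by move: t0_le H1 H2 H3 H4; lra.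
by rewrite ler_pM2l.
Qed.

(** The area on [1, 2] starts at 0 and loses at most [pi / 2 s <= A0 / 2]; the value at 1 is at
    least the average over this interval. *)
Lemma spike_far_ge s : 2 * w <= 1 -> 0 < s <= t0 -> - (A0 / 2) <= y 1 s.
Proof.
move=> w1 /andP[s0 st].
have H1 : integral_on 1 2 (y ^~ 0) - pi / 2 * s <= integral_on 1 2 (y ^~ s).
  have := @flow_area_ge 1 2 0 s; rewrite subr0; apply.
    by rewrite ler01 ler1n.
  by rewrite lexx ltW.
rewrite area0_ge ?ler1n// in H1; last by move: w_gt0; lra.
have H2 : integral_on 1 2 (y ^~ s) <= y 1 s * (2 - 1).
  rewrite -integral_on_cst ?ler1n//; apply: le_integral_on => //.
    by move=> ?; exact: cvg_cst.
  by move=> x /andP[x1 _]; apply: flow_decreasing => //; rewrite ler01.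
have : pi / 2 * s <= pi / 2 * t0 by rewrite ler_wpM2l// divr_ge0 ?pi_ge0.
by move: t0_le; lra.
Qed.

(** The area on [0, 1] is at most [A0 / 2 + pi / 2 t0 <= A0], so [y(1, t0) <= A0] by monotonicity,
    and the mean value theorem on [0, 1] gives the slope. *)
Lemma spike_slope : 2 * w <= 1 -> exists c, y 0 t0 - A0 <= - p c t0.
Proof.
move=> w1; have [||c _ E] := @MVT R (y ^~ t0) (p ^~ t0) 0 1 ltr01.
- by move=> x _; have [] := yF.2 x t0 t0_gt0.
- exact: continuous_subspaceT.
exists c; have := @flow_area_le 0 1 t0.
rewrite lexx ler01 area0_cat; last by move: w_gt0; lra.
move=> /(_ isT t0_gt0) H1.
have H2 := @y_ge_avg 0 1 t0 t0_gt0.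
rewrite lexx ler01 in H2; have := H2 isT.
by rewrite subr0 mulr1 in E *; move: t0_le; lra.
Qed.

(** * The area weighted by 1 / x *)

Section LogWeight.
Hypothesis b_lt1 : 2 * w < 1.
Local Notation b := (2 * w).
Let L := - ln b.
(* The cutoff makes the weight 1 / x continuous on the whole line. *)
Let inv x : R := (Num.max b x)^-1.

Let b_gt0 : 0 < b. Proof. by rewrite mulr_gt0. Qed.

Let max_gt0 x : 0 < Num.max b x. Proof. by rewrite lt_max b_gt0. Qed.

Let inv_cont : continuous inv.
Proof.
move=> x; apply: (@continuous_compf _ _ (fun v => v^-1) (fun x => Num.max b x)).
  by apply: inv_continuous; rewrite gt_eqF.
by apply: continuous_max; [exact: cvg_cst|exact: cvg_id].
Qed.

Let invE x : b <= x -> inv x = x^-1.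
Proof. by move=> bx; rewrite /inv max_r. Qed.

Let is_derive_inv x : 0 < x -> is_derive x 1 (fun x : R => x^-1) (- (x^-1 ^+ 2)).
Proof.
move=> x0; have := @is_deriveV _ id x 1 1 (lt0r_neq0 x0) (is_derive_id x (1 : R)).
by rewrite /GRing.scale/= mulr1 exprVn.
Qed.

(** Subtracting 1 makes the weight vanish at [x = 1], so that no flux through that end enters. *)
Let weight x := inv x - 1.

Let weight_cont : continuous weight.
Proof.
by move=> x; apply: continuous_subf; [exact: inv_cont|exact: cvg_cst].
Qed.

(** The weighted area on [0, 1]: the weight is 1 / x - 1 on [b, 1] and keeps its value at [b] on
    [0, b]. *)
Let E t := (b^-1 - 1) * integral_on 0 b (y ^~ t) +
  integral_on b 1 (fun x => weight x * y x t).

Let E0 : E 0 = (b^-1 - 1) * (A0 / 2).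
Proof.
rewrite /E area0_cat; last by move: w_gt0; lra.
rewrite [X in _ + X](_ : _ = 0) ?addr0//.
rewrite (@eq_integral_on _ _ _ _ (fun=> 0)).
  by rewrite integral_on_cst ?mul0r// ltW.
by move=> x /andP[bx _]; rewrite y00 ?mulr0//; move: w_gt0; lra.
Qed.

Let binv_ge1 : 0 <= b^-1 - 1.
Proof. by rewrite subr_ge0 invf_ge1// ltW. Qed.

(** Since [y <= M] at time [t0], it suffices that the total weight is
    [(1 - b) + (L - (1 - b)) = L]. *)
Let E_le : E t0 <= M * L.
Proof.
have H1 : integral_on 0 b (y ^~ t0) <= M * b.
  rewrite -[b in leRHS]subr0 -integral_on_cst//; last exact: ltW.
  apply: le_integral_on => //; first by move=> ?; exact: cvg_cst.
  by move=> x /andP[x0 _]; exact: y_le_M.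
have weight_ge0 x : b <= x <= 1 -> 0 <= weight x.
  move=> /andP[bx x1]; rewrite /weight invE// subr_ge0 invf_ge1//.
  exact: lt_le_trans bx.
have H2 : integral_on b 1 (fun x => weight x * y x t0) <=
    integral_on b 1 (fun x => M * weight x).
  apply: le_integral_on.
  - by move=> x; exact: (continuous_mulf (weight_cont (x := x)) (@y_cont t0 x)).
  - by move=> x; exact: (continuous_scalef (weight_cont (x := x))).
  - move=> x bx1; rewrite mulrC ler_wpM2r ?weight_ge0// y_le_M//.
    by case/andP: bx1 => bx _; rewrite (le_trans _ bx)// ltW.
have H3 : integral_on b 1 weight = L - (1 - b).
  have dln x : b <= x <= 1 -> is_derive x 1 (fun x => ln x - x) (weight x).
    move=> /andP[bx _]; rewrite /weight invE//.
    have x0 : 0 < x by exact: lt_le_trans bx.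
    exact: is_derive_subf (is_derive1_ln x0) (is_derive_id x (1 : R)).
  by rewrite (integral_on_derive (ltW b_lt1) weight_cont dln) ln1 /L; lra.
rewrite integral_onZ// H3 in H2.
have H4 : (b^-1 - 1) * integral_on 0 b (y ^~ t0) <= (b^-1 - 1) * (M * b).
  by rewrite ler_wpM2l.
have H5 : (b^-1 - 1) * (M * b) = M * (1 - b).
  by field; rewrite gt_eqF.
by rewrite /E; lra.
Qed.

Let dE t := (b^-1 - 1) * (atan (p b t) - atan (p 0 t)) +
  integral_on b 1 (fun x => weight x * (q x t / (1 + p x t ^+ 2))).

Let E_cont : continuous E.
Proof.
move=> t; have cF x s : jcontinuous_at (fun x t => weight x * y x t) x s.
  exact: (continuous_mulf (jcontinuous_of_fst (weight_cont (x := x))) (yF.1 x s)).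
have c1 := continuous_scalef (k := b^-1 - 1) (@flow_area_continuous 0 b t).
have c2 := continuous_integral_on (F := fun x t => weight x * y x t)
  (a := b) (b := 1) cF (x := t).
exact: (continuous_addf c1 c2).
Qed.

Let E_derive t : 0 < t -> is_derive t 1 E (dE t).
Proof.
move=> t_gt0; apply: is_derive_addf.
  have := is_derive_mulf (is_derive_cstf (b^-1 - 1) t)
    (flow_area_derive (ltW b_gt0) t_gt0).
  by rewrite mul0r add0r.
pose F x t : R := weight x * y x t.
pose G x t : R := weight x * (q x t / (1 + p x t ^+ 2)).
have cF s : continuous (F ^~ s).
  by move=> x; exact: (continuous_mulf (weight_cont (x := x)) (@y_cont s x)).
have dF x (s : R) : 0 < s -> is_derive s 1 (F x) (G x s).
  move=> s0; have [_ _ y_t _ _] := yF.2 x s s0.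
  by have := is_derive_mulf (is_derive_cstf (weight x) s) y_t; rewrite mul0r add0r.
have cG x (s : R) : 0 < s -> jcontinuous_at G x s.
  move=> s0; apply: continuous_mulf.
    exact: (jcontinuous_of_fst (weight_cont (x := x))).
  exact: (flow_jcontinuous_dt yF).
exact: (is_derive_integral_on b 1 t_gt0 cF dF cG).
Qed.

(** Integration by parts leaves the integral of [atan p / x ^ 2] and a nonnegative term at 0; the
    boundary terms at [b] cancel. The tangent inequality with [l = k / x] then replaces [atan p] by
    an expression linear in [p], which integrates exactly. The slope [k] of the tangent point in 1 /
    x stays free. *)
Let dE_ge k s : 0 < k -> 0 < s <= t0 ->
  k ^- 2 * (2 * k * L - (1 + A0 / 2 + 2 * M)) - pi / 2 * (b^-1 - 1) <= dE s.
Proof.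
move=> k0 /andP[s0 st].
have ca : continuous (fun x => atan (p x s)) by exact: (flow_continuous_atan yF).
have cq : continuous (fun x => q x s / (1 + p x s ^+ 2)).
  exact: (flow_continuous_dt yF).
have cinv2 : continuous (fun x => inv x ^+ 2).
  move=> x; apply: (continuous_compf (h := fun v => v ^+ 2)).
    exact: exprn_continuous.
  exact: inv_cont.
have b1 := ltW b_lt1.
pose f x : R := weight x * (q x s / (1 + p x s ^+ 2)).
pose g x : R := inv x ^+ 2 * atan (p x s).
have cg : continuous g.
  by move=> x; exact: (continuous_mulf (cinv2 x) (ca x)).
have cf : continuous f.
  by move=> x; exact: (continuous_mulf (weight_cont (x := x)) (cq x)).
have by_parts : integral_on b 1 f =
    - ((b^-1 - 1) * atan (p b s)) + integral_on b 1 g.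
  have cfg : continuous (fun x => f x - g x).
    by move=> x; exact: (continuous_subf (cf x) (cg x)).
  have : integral_on b 1 (fun x => f x - g x) = - ((b^-1 - 1) * atan (p b s)).
    have d x : b <= x <= 1 ->
        is_derive x 1 (fun x => (x^-1 - 1) * atan (p x s)) (f x - g x).
      move=> /andP[bx _]; have x0 : 0 < x by exact: lt_le_trans bx.
      have := is_derive_mulf (is_derive_subf (is_derive_inv x0) (is_derive_cstf 1 x))
        (flow_is_derive_atan yF x s0).
      by move/is_derive_eq; apply; rewrite /f /g /weight invE//; lra.
    by rewrite (integral_on_derive b1 cfg d) invr1 subrr mul0r sub0r.
  move=> <-; rewrite -integral_on_add//; congr integral_on.
  by apply/funext => x; rewrite subrK.
pose h x : R := k ^- 2 * (2 * k * inv x - 1 + p x s) - pi / 2 * inv x ^+ 2.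
have ch : continuous h.
  move=> x; have c1 : {for x, continuous (fun=> (1 : R))} by exact: cvg_cst.
  exact: (continuous_subf (continuous_scalef (continuous_addf (continuous_subf
    (continuous_scalef (@inv_cont x)) c1) (flow_continuous_p yF s0 (x := x))))
    (continuous_scalef (cinv2 x))).
have hg : integral_on b 1 h <= integral_on b 1 g.
  apply: le_integral_on => // x /andP[bx _].
  have x0 : 0 < x by exact: lt_le_trans bx.
  have px : p x s <= 0 by apply: p_le0 => //; exact: ltW.
  have := atan_tangent (k * inv x) px.
  rewrite -(@ler_pM2l _ (k ^- 2)) ?invr_gt0 ?exprn_gt0//.
  have -> : k ^- 2 * ((k * inv x) ^+ 2 * atan (p x s)) = g x.
    by rewrite /g; field; rewrite gt_eqF.
  suff -> : k ^- 2 * (2 * (k * inv x) - 1 + p x s - pi / 2 * (k * inv x) ^+ 2) = h x.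
    by [].
  by rewrite /h; field; rewrite gt_eqF.
have Ih : integral_on b 1 h =
    k ^- 2 * (2 * k * L - (1 - b) + (y 1 s - y b s)) - pi / 2 * (b^-1 - 1).
  pose K x := k ^- 2 * (2 * k * ln x - x + y x s) + pi / 2 * x^-1.
  have dK x : b <= x <= 1 -> is_derive x 1 K (h x).
    move=> /andP[bx _]; have x0 : 0 < x by exact: lt_le_trans bx.
    have [y_x _ _ _ _] := yF.2 x s s0.
    have := is_derive_addf (is_derive_mulf (is_derive_cstf (k ^- 2) x)
      (is_derive_addf (is_derive_subf (is_derive_mulf (is_derive_cstf (2 * k) x)
        (is_derive1_ln x0)) (is_derive_id x (1 : R))) y_x))
      (is_derive_mulf (is_derive_cstf (pi / 2) x) (is_derive_inv x0)).
    by move/is_derive_eq; apply; rewrite /h invE//; lra.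
  by rewrite (integral_on_derive b1 ch dK) /K ln1 invr1 /L; lra.
(* Integrating [p] leaves [y(1, s) - y(b, s)], bounded below by the two spike estimates. *)
have y1 : - (A0 / 2) <= y 1 s by apply: spike_far_ge; rewrite ?s0.
have yb : y b s <= 2 * M by apply: spike_outer_le; rewrite s0.
have : k ^- 2 * (2 * k * L - (1 + A0 / 2 + 2 * M)) <=
    k ^- 2 * (2 * k * L - (1 - b) + (y 1 s - y b s)).
  rewrite ler_wpM2l ?invr_ge0 ?exprn_ge0 ?ltW//.
  by move: b_gt0; lra.
have : (b^-1 - 1) * atan (p 0 s) <= 0.
  by rewrite mulr_ge0_le0// atan_le0.
by rewrite /dE -/f by_parts mulrBr; lra.
Qed.

Lemma spike_log_bound : t0 * L <= M * (1 + A0 / 2 + 2 * M).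
Proof.
(* With this [k] the main term [2 L t0 / k] is [2 M L], twice the upper bound [M L] for [E t0], so a
   full [M L] remains to be absorbed by the error. *)
pose k := t0 / M; have k0 : 0 < k by rewrite divr_gt0.
set C := 1 + _ + _.
have t00 : (0 : R) <= 0 <= t0 by rewrite lexx ltW.
have := @ge_of_derive_ge R E dE
  (k ^- 2 * (2 * k * L - C) - pi / 2 * (b^-1 - 1)) 0 t0 t00 E_cont E_derive.
rewrite E0 subr0 => H.
have {}H := le_trans (H _) E_le.
have {}H : (b^-1 - 1) * (A0 / 2) +
    (k ^- 2 * (2 * k * L - C) - pi / 2 * (b^-1 - 1)) * t0 <= M * L.
  by apply: H => r /andP[r0 rt]; apply: dE_ge => //; rewrite r0 ltW.
(* The initial value [E 0] pays for the loss [pi / 2 (b^-1 - 1) t0], by [pi t0 <= A0] once more. *)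
have H1 : 0 <= (b^-1 - 1) * (A0 - pi * t0) by rewrite mulr_ge0// subr_ge0.
have Mn0 : M != 0 by rewrite gt_eqF.
have t0n0 : t0 != 0 by rewrite gt_eqF.
have H2 : k ^- 2 * (2 * k * L - C) * t0 = 2 * M * L - C * M ^+ 2 / t0.
  by rewrite /k; field; rewrite Mn0 t0n0.
have {H H1 H2} : M * L <= C * M ^+ 2 / t0 by lra.
rewrite ler_pdivlMr// => H.
by rewrite -(@ler_pM2l _ M)//; lra.
Qed.

End LogWeight.
End Spike.
End AreaBalance.

(** * Initial data and norms *)

(** For [w > 0], the triangle of height [A / w] over [-w, w], hence of area [A]. *)
Definition tent {R : realType} (A w x : R) : R :=
  A / w ^+ 2 * Num.max (w - `|x|) 0.

Section Tent.
Context {R : realType}.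
Variables A w : R.
Hypotheses (A_gt0 : 0 < A) (w_gt0 : 0 < w).
Implicit Types x c : R.

Let k_ge0 : 0 <= A / w ^+ 2.
Proof. by rewrite divr_ge0 ?sqr_ge0 ?ltW. Qed.

Lemma tent_ge0 x : 0 <= tent A w x.
Proof. by rewrite mulr_ge0// le_max lexx orbT. Qed.

Lemma tent_out x : w <= x -> tent A w x = 0.
Proof.
move=> wx; rewrite /tent max_r ?mulr0// subr_le0 (le_trans wx)//.
exact: ler_norm.
Qed.

Lemma tentN x : tent A w (- x) = tent A w x.
Proof. by rewrite /tent normrN. Qed.

(** Reflection about [c >= 0] brings points right of [c] no farther from the origin; this is the
    initial condition for the reflection argument. *)
Lemma tent_reflect c x : 0 <= c -> c <= x -> tent A w x <= tent A w (2 * c - x).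
Proof.
move=> c0 cx; rewrite ler_wpM2l//.
have : `|2 * c - x| <= `|x|.
  by rewrite ler_norml ger0_norm; lra.
rewrite ge_max le_max [X in _ && X]le_max lexx orbT andbT => H.
by apply/orP; left; lra.
Qed.

Lemma tent_lipschitz : lipschitz (tent A w).
Proof.
have PF : ProperFilter (globally ([set: R] `*` [set: R])).
  by apply: (globally_properfilter (a := (0, 0))).
apply: (@klipschitzW _ _ _ (A / w ^+ 2)) => -[x y] _ /=.
rewrite /tent -mulrBr normrM ger0_norm// ler_wpM2l//.
apply: le_trans (ler_dist_dist x y).
have [] := leP (w - `|x|) 0; have [] := leP (w - `|y|) 0 => *;
  rewrite ler_norml; have := ler_norm (`|x| - `|y|);
  have := ler_norm (`|y| - `|x|); rewrite (distrC `|y|); lra.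
Qed.

Lemma continuous_tent : continuous (tent A w).
Proof.
move=> x; have cabs : {for x, continuous (fun x => w - `|x|)}.
  apply: continuous_subf; first exact: cvg_cst.
  exact: norm_continuous.
exact: (continuous_scalef (continuous_compf (@continuous_pos_part R _) cabs)).
Qed.

Lemma integral_on_tent : integral_on 0 w (tent A w) = A / 2.
Proof.
pose F x := A / w ^+ 2 * (w * x - x ^+ 2 / 2).
have dF x : 0 <= x <= w -> is_derive x 1 F (tent A w x).
  move=> /andP[x0 xw].
  have dx := is_derive_id x (1 : R).
  have := is_derive_mulf (is_derive_cstf (A / w ^+ 2) x) (is_derive_subf
    (is_derive_mulf (is_derive_cstf w x) dx)
    (is_derive_mulf (is_derive_mulf dx dx) (is_derive_cstf (2^-1) x))).
  by move/is_derive_eq; apply; rewrite /tent ger0_norm// max_l ?subr_ge0//; lra.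
rewrite (integral_on_derive (ltW w_gt0) continuous_tent dF) /F.
by field; rewrite gt_eqF.
Qed.

Lemma Lnorm1_tent : ('N[lebesgue_measure]_1[EFin \o tent A w] = A%:E)%E.
Proof.
rewrite Lnorm1.
under eq_integral => x _ do rewrite /= ger0_norm ?tent_ge0//.
rewrite (ge0_symfun_integralT tent_ge0 continuous_tent); last first.
  by move=> x; rewrite /= tentN.
have -> : (\int[lebesgue_measure]_(x in [set x : R | (0 <= x)%R]) (tent A w x)%:E
    = \int[lebesgue_measure]_(x in `[0%R, w]) (tent A w x)%:E)%E.
  rewrite integral_mkcond [RHS]integral_mkcond; apply: eq_integral => x _.
  rewrite /patch; have [x0|x0] := leP 0 x; last first.
    by rewrite !memNset//= ?in_itv/= leNgt x0.
  rewrite mem_set//; have [xw|wx] := leP x w.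
    by rewrite mem_set//= in_itv/= x0 xw.
  rewrite memNset; first by rewrite tent_out// ltW.
  by rewrite /= in_itv/= (leNgt x w) wx andbF.
rewrite -[X in (_ * X)%E]fineK; last first.
  apply: integrable_fin_num => //.
  exact: (continuous_integrable_on 0 w continuous_tent).
have -> : fine (\int[lebesgue_measure]_(x in `[0%R, w]) (tent A w x)%:E) = A / 2.
  exact: integral_on_tent.
by rewrite -EFinM mulrCA divff ?mulr1.
Qed.

End Tent.

(** * Essential suprema of continuous functions *)

Section SupNorm.
Context {R : realType}.
Local Notation mu := (@lebesgue_measure R).

Lemma Lnormy_ge (f : R -> R) (x0 d : R) : {for x0, continuous f} ->
  d < `|f x0| -> (d%:E <= 'N[mu]_+oo[EFin \o f])%E.
Proof.
(* The definition yields the essential supremum only when the whole space has positive measure. *)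
move=> cf dfx; rewrite unlock /Lnorm/= ifT; last first.
  have := lebesgue_measure_itv (`]-oo, +oo[ : interval R).
  by rewrite set_itvNyy /= => ->; exact: ltry.
rewrite leNgt; apply/negP => sd.
have [N [mN N0 hN]] := ess_sup_ge mu (abse \o (EFin \o f)).
have cnf : {for x0, continuous (fun x => `|f x|)}.
  exact: (continuous_compf (@norm_continuous _ _ _) cf).
have [e /= e0 He] : \forall z \near x0, d < `|f z|.
  exact: (cvgr_gt `|f x0| cnf).
pose I : set R := `]x0 - e, x0 + e[%classic.
(* By continuity [|f| > d] on an interval of length [2 e], which cannot lie in the null set [N]. *)
have IN : I `<=` N.
  move=> z; rewrite /I /= in_itv/= => /andP[z1 z2]; apply: hN => /= H.
  have dz : d < `|f z| by apply: He; rewrite /= ltr_distlC z1.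
  by have := le_lt_trans H sd; rewrite lte_fin ltNge ltW.
have muI := lebesgue_measure_itv `]x0 - e, x0 + e[; rewrite /= lte_fin in muI.
have : (mu I <= mu N)%E.
  by apply: le_measure => //; rewrite inE//; exact: measurable_itv.
rewrite N0 [X in (X <= _)%E]muI ifT -?EFinB ?lee_fin; first lra.
by lra.
Qed.

End SupNorm.

(** * Solutions starting with tents *)

Section SpikeSolutions.
Context {R : realType}.
Variables (A0 w : R) (y : R -> R -> R).
Hypotheses (A0_gt0 : 0 < A0) (w_gt0 : 0 < w) (w2_lt1 : 2 * w < 1)
  (ysol : Ecker_Huisken_solution (tent A0 w) y).
Variable t0 : R.
Hypotheses (t0_gt0 : 0 < t0) (t0_le : pi * t0 <= A0).

Let Y x t : R := y x (Num.max t 0).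

Let Y0 x : Y x 0 = tent A0 w x.
Proof. by rewrite /Y maxxx; case: ysol. Qed.

Let Yt0 x : Y x t0 = y x t0.
Proof. by rewrite /Y max_l// ltW. Qed.

Let yF : csf_flow Y (dx y) (dx (dx y)) := flow_of_solution ysol.

Let slope_le0 x t : 0 <= x -> 0 < t -> dx y x t <= 0.
Proof.
move=> x0 t_gt0; apply: (flow_slope_le0 yF t_gt0) => z xz.
by rewrite !Y0; exact: tent_reflect.
Qed.

Let Y_out x : w <= x -> Y x 0 = 0.
Proof. by rewrite Y0; exact: tent_out. Qed.

Let Y_area : integral_on 0 w (Y ^~ 0) = A0 / 2.
Proof.
by rewrite -(integral_on_tent _ w_gt0); apply: eq_integral_on => x _; exact: Y0.
Qed.

Lemma tent_solution_height B : 0 < B ->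
  B * (1 + A0 / 2 + 2 * B) < t0 * - ln (2 * w) -> B < y 0 t0.
Proof.
move=> B0; rewrite !ltNge; apply: contra => yB.
rewrite -Yt0 in yB.
exact: (spike_log_bound yF slope_le0 w_gt0 Y_out Y_area t0_gt0 t0_le B0 yB w2_lt1).
Qed.

Lemma tent_solution_Lnormy d : d < y 0 t0 ->
  (d%:E <= 'N[lebesgue_measure]_+oo[EFin \o (y ^~ t0)])%E.
Proof.
move=> dy; apply: (@Lnormy_ge R _ 0).
  have -> : y ^~ t0 = Y ^~ t0 by apply/funext => x; rewrite Yt0.
  exact: flow_continuous yF t0 0.
exact: lt_le_trans (ler_norm _).
Qed.

Lemma tent_solution_slope_Lnormy d : d + A0 < y 0 t0 ->
  (d%:E <= 'N[lebesgue_measure]_+oo[EFin \o (dx y ^~ t0)])%E.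
Proof.
move=> dy.
have [c] := spike_slope yF slope_le0 w_gt0 Y_out Y_area t0_gt0 t0_le (ltW w2_lt1).
rewrite Yt0 => yc; apply: (@Lnormy_ge R _ c).
  exact: (flow_continuous_p yF t0_gt0).
by rewrite -normrN (lt_le_trans _ (ler_norm _))//; lra.
Qed.

End SpikeSolutions.

Theorem theorem1p1 (R : realType) (A0 : R) (hA0 : 0 < A0) :
  exists y0 : nat -> R -> R,
    (forall n, [/\ lipschitz (y0 n),
                   forall x, 0 <= y0 n x &
                   ('N[lebesgue_measure]_1[EFin \o y0 n] = A0%:E)%E]) /\
    forall y : nat -> R -> R -> R,
      (forall n, Ecker_Huisken_solution (y0 n) (y n)) ->
      forall t0 : R, 0 < t0 <= A0 / pi ->
        ('N[lebesgue_measure]_+oo[EFin \o (y n ^~ t0)]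
           @[n --> \oo] --> +oo)%E /\
        ('N[lebesgue_measure]_+oo[EFin \o (dx (y n) ^~ t0)]
           @[n --> \oo] --> +oo)%E.
Proof.
(* Then [2 w = 1 / (n + 2)] is below 1, as the logarithmic weight demands, and
   [- ln (2 w) = ln (n + 2)]. *)
pose w n : R := (2 * n.+2%:R)^-1.
have w0 n : 0 < w n by rewrite invr_gt0 mulr_gt0.
have w2 n : 2 * w n = n.+2%:R^-1 by rewrite /w invfM mulVKf.
have w2_lt1 n : 2 * w n < 1 by rewrite w2 invf_lt1// ltr1n.
exists (fun n => tent A0 (w n)); split.
  move=> n; split; first exact: tent_lipschitz.
    exact: tent_ge0.
  exact: Lnorm1_tent.
move=> y ysol t0 /andP[t0_gt0]; rewrite ler_pdivlMr ?pi_gt0// mulrC => t0_le.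
have high B : 0 < B -> \forall n \near \oo, B < y n 0 t0.
  (* The height exceeds [B] as soon as [K < ln (n + 2)], for which [n > exp K] is enough. *)
  move=> B0; pose K := t0^-1 * (B * (1 + A0 / 2 + 2 * B)).
  near=> n; apply: (tent_solution_height hA0 (w0 n) (w2_lt1 n) (ysol n)) => //.
  rewrite w2 lnV ?posrE// opprK -ltr_pdivrMl// -/K.
  rewrite -ltr_expR lnK ?posrE//.
  apply: (@lt_trans _ _ n%:R); last by rewrite ltr_nat ltnW.
  by near: n; exact: nbhs_infty_gtr.
split; apply/cvgeyPge => d.
- near=> n; apply: (tent_solution_Lnormy (ysol n)) => //.
  (* The height estimate needs a positive threshold, while [d] is arbitrary. *)
  apply: (@le_lt_trans _ _ (Num.max d 1)); first by rewrite le_max lexx.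
  by near: n; apply: high; rewrite lt_max ltr01 orbT.
- near=> n; apply: (tent_solution_slope_Lnormy hA0 (w0 n) (w2_lt1 n) (ysol n)) => //.
  apply: (@le_lt_trans _ _ (Num.max (d + A0) 1)); first by rewrite le_max lexx.
  by near: n; apply: high; rewrite lt_max ltr01 orbT.
Unshelve. all: by end_near. Qed.
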